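(* Let $P$ be a logic program and $\Delta$ be a filter that is DN for $P$. Let $\xi$ be an SLD-derivation of $P\cup\{Q_0\}$ and let $Q'_0$ be a query that is $\Delta$-more general than $Q_0$. Then there exists an SLD-derivation of $P\cup\{Q'_0\}$ that is a $\Delta$-lift of $\xi$.
   Context: Fix a first-order language $\mathcal L$ with infinitely many constant symbols; $\Pi$ is its set of relation symbols, each $p\in\Pi$ with a unique arity $arity(p)$; $TU_{\mathcal L}$ is the set of all (ground and non-ground) terms. $[1,n]=\{1,\dots,n\}$. A query is a finite sequence of atoms. A logic program is a finite set of definite clauses. SLD-derivation step: given a query $\mathbf A,B,\mathbf C$ and a clause $c$, take a variant $H\leftarrow\mathbf B$ of $c$ variable disjoint from the query with $B,H$ unifiable and $\theta$ an mgu; then $\mathbf A,B,\mathbf C\Rightarrow_c^\theta(\mathbf A,\mathbf B,\mathbf C)\theta$ (selected atom $B$). An SLD-derivation of $P\cup\{Q_0\}$ is a maximal sequence of such steps from $Q_0$ using clauses of $P$, with standardization apart (each input clause variable disjoint from $Q_0$ and from earlier mgus and input clauses). A term-condition is a map $TU_{\mathcal L}\to\{\mathtt{true},\mathtt{false}\}$. A filter $\Delta$ assigns to each $p\in\Pi$ a partial function $\Delta(p)$ from $[1,arity(p)]$ to term-conditions, with domain $Dom(\Delta(p))$. For a substitution $\eta$, an atom $A=p(s_1,\dots,s_n)$ is $\Delta$-more general than an atom $B$ for $\eta$ if $B=p(t_1,\dots,t_n)$, $t_i=s_i\eta$ for all $i\in[1,n]\setminus Dom(\Delta(p))$, and $\Delta(p)(i)(s_i)=\mathtt{true}$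 for all $i\in Dom(\Delta(p))$. A query $A_1,\dots,A_n$ is $\Delta$-more general than a query $B_1,\dots,B_m$ for $\eta$ if $n=m$ and each $A_i$ is $\Delta$-more general than $B_i$ for $\eta$; it is $\Delta$-more general if this holds for some $\eta$. Given sequences of SLD-derivation steps $\xi=Q_0\Rightarrow_{c_1}Q_1\Rightarrow_{c_2}\cdots$ and $\xi'=Q'_0\Rightarrow_{c_1}Q'_1\Rightarrow_{c_2}\cdots$ (same clauses at corresponding steps), $\xi'$ is a $\Delta$-lift of $\xi$ if $\xi$ has the same or smaller length than $\xi'$ and, for each $Q_i$ in $\xi$, $Q'_i$ is $\Delta$-more general than $Q_i$ and atoms in the same positions are selected in $Q_i$ and $Q'_i$. A filter $\Delta$ is DN for a clause $c$ if for every SLD-derivation step $Q\Rightarrow_c Q_1$ and every query $Q'$ that is $\Delta$-more general than $Q$, there is a query $Q'_1$ such that $Q'\Rightarrow_cQ'_1$ and $Q'\Rightarrow_cQ'_1$ is a $\Delta$-lift of $Q\Rightarrow_cQ_1$. $\Delta$ is DN for a program $P$ if it is DN for each clause of $P$. *)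

(* Defs.v *)
From Stdlib Require List.
From mathcomp Require Import all_boot.
From mathcomp Require Import boolp classical_sets cardinality.

Set Implicit Arguments.
Unset Strict Implicit.
Unset Printing Implicit Defensive.

Local Open Scope classical_set_scope.

Record language := Language {
  fsym : Type;
  farity : fsym -> nat;
  psym : Type;
  parity : psym -> nat;
  infinite_constants : infinite_set [set f | farity f = 0] }.

(* Variables are natural numbers. *)
Inductive term (L : language) : Type :=
| Var of nat
| App (f : fsym L) of {ffun 'I_(farity f) -> term L}.

Arguments Var {L} _.

Record atom (L : language) := Atom {
  apred : psym L;
  aargs : {ffun 'I_(parity apred) -> term L} }.

Definition query (L : language) := seq (atom L).

Record clause (L : language) := Clause { chead : atom L; cbody : query L }.

Fixpoint tvars (L : language) (t : term L) : set nat :=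
  match t with
  | Var x => [set x]
  | App f a => [set x | exists i, tvars (a i) x]
  end.

Definition avars (L : language) (A : atom L) : set nat :=
  [set x | exists i, tvars (aargs A i) x].

Definition qvars (L : language) (Q : query L) : set nat :=
  [set x | exists2 A, List.In A Q & avars A x].

Definition cvars (L : language) (c : clause L) : set nat :=
  avars (chead c) `|` qvars (cbody c).

Record subst (L : language) := Subst {
  sfun :> nat -> term L;
  sfinite : finite_set [set x | sfun x <> Var x] }.

Definition svars (L : language) (s : subst L) : set nat :=
  [set x | s x <> Var x] `|` [set x | exists2 y, s y <> Var y & tvars (s y) x].

Fixpoint tsubst (L : language) (s : nat -> term L) (t : term L) : term L :=
  match t with
  | Var x => s x
  | App f a => App [ffun i => tsubst s (a i)]
  end.

Definition asubst (L : language) (s : subst L) (A : atom L) : atom L :=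
  Atom [ffun i => tsubst s (aargs A i)].

Definition qsubst (L : language) (s : subst L) (Q : query L) : query L :=
  [seq asubst s A | A <- Q].

Definition csubst (L : language) (s : subst L) (c : clause L) : clause L :=
  Clause (asubst s (chead c)) (qsubst s (cbody c)).

Definition renaming (L : language) (s : subst L) : Prop :=
  exists2 f : nat -> nat, bijective f & forall x, s x = Var (f x).

Definition variant (L : language) (c d : clause L) : Prop :=
  exists2 r : subst L, renaming r & d = csubst r c.

Definition unifier (L : language) (s : subst L) (A B : atom L) : Prop :=
  asubst s A = asubst s B.

(* Neither idempotence nor relevance is required of an mgu. *)
Definition is_mgu (L : language) (s : subst L) (A B : atom L) : Prop :=
  unifier s A B /\
  forall u : subst L, unifier u A B ->
    exists g : subst L, forall x, u x = tsubst g (s x).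

(* Data of a step: the clause labelling it, the input clause (the variant of
   it which is actually used), the 0-based position of the selected atom, and
   the mgu. *)
Record step_data (L : language) := StepData {
  sclause : clause L;
  sinput : clause L;
  spos : nat;
  smgu : subst L }.

Definition sld_step (L : language) (Q : query L) (d : step_data L)
    (Q1 : query L) : Prop :=
  exists (A : query L) (B : atom L) (C : query L),
    [/\ Q = A ++ B :: C,
        size A = spos d,
        variant (sclause d) (sinput d),
        cvars (sinput d) `&` qvars Q = set0 &
        is_mgu (smgu d) B (chead (sinput d)) /\
        Q1 = qsubst (smgu d) (A ++ cbody (sinput d) ++ C)].

(* A finite or infinite sequence Q_0 => Q_1 => ...: [slen] is its number of
   steps ([None] when infinite), [squery i] is Q_i and [sstep i] is the data of
   the step Q_i => Q_(i+1).  The values of [squery] and [sstep] beyond the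
   length are meaningless. *)
Record sld_seq (L : language) := SldSeq {
  slen : option nat;
  squery : nat -> query L;
  sstep : nat -> step_data L }.

Definition has_step (L : language) (xi : sld_seq L) (i : nat) : Prop :=
  if slen xi is Some n then i < n else True.

Definition has_query (L : language) (xi : sld_seq L) (i : nat) : Prop :=
  if slen xi is Some n then i <= n else True.

Definition is_sld_seq (L : language) (xi : sld_seq L) : Prop :=
  forall i, has_step xi i -> sld_step (squery xi i) (sstep xi i) (squery xi i.+1).

Definition single_step (L : language) (Q : query L) (d : step_data L)
    (Q1 : query L) : sld_seq L :=
  SldSeq (Some 1) (fun i => if i is 0 then Q else Q1) (fun=> d).

(* The input clause [c] may be used at step [i] of [xi]. *)
Definition standardized_apart (L : language) (xi : sld_seq L) (i : nat)
    (c : clause L) : Prop :=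
  cvars c `&` qvars (squery xi 0) = set0 /\
  forall j, j < i ->
    cvars c `&` svars (smgu (sstep xi j)) = set0 /\
    cvars c `&` cvars (sinput (sstep xi j)) = set0.

Definition sld_derivation (L : language) (P : set (clause L)) (Q0 : query L)
    (xi : sld_seq L) : Prop :=
  [/\ squery xi 0 = Q0,
      is_sld_seq xi,
      forall i, has_step xi i ->
        P (sclause (sstep xi i)) /\
        standardized_apart xi i (sinput (sstep xi i)) &
      (* maximality *)
      forall n, slen xi = Some n ->
        ~ exists (d : step_data L) (Q1 : query L),
            [/\ P (sclause d), sld_step (squery xi n) d Q1 &
                standardized_apart xi n (sinput d)]].

Definition term_condition (L : language) := term L -> bool.

(* [D p i = None] when [i] is outside of Dom(D(p)); positions are 0-based. *)
Definition lp_filter (L : language) :=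
  forall p : psym L, 'I_(parity p) -> option (term_condition L).

Definition atom_more_general_for (L : language) (D : lp_filter L) (eta : subst L)
    (A B : atom L) : Prop :=
  exists (p : psym L) (s t : {ffun 'I_(parity p) -> term L}),
    [/\ A = Atom s, B = Atom t &
        forall i, match D p i with
                  | None => t i = tsubst eta (s i)
                  | Some f => f (s i) = true
                  end].

Definition query_more_general_for (L : language) (D : lp_filter L) (eta : subst L)
    (Q Q' : query L) : Prop :=
  List.Forall2 (atom_more_general_for D eta) Q Q'.

Definition query_more_general (L : language) (D : lp_filter L)
    (Q Q' : query L) : Prop :=
  exists eta : subst L, query_more_general_for D eta Q Q'.

Definition length_le (m n : option nat) : Prop :=
  match m, n with
  | _, None => True
  | None, Some _ => False
  | Some m, Some n => m <= n
  end.

(* [xi'] is a D-lift of [xi]; both are meant to satisfy [is_sld_seq]. *)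
Definition is_lift (L : language) (D : lp_filter L) (xi xi' : sld_seq L) : Prop :=
  [/\ length_le (slen xi) (slen xi'),
      forall i, has_step xi i ->
        sclause (sstep xi' i) = sclause (sstep xi i) /\
        spos (sstep xi' i) = spos (sstep xi i) &
      forall i, has_query xi i ->
        query_more_general D (squery xi' i) (squery xi i)].

Definition DN_clause (L : language) (D : lp_filter L) (c : clause L) : Prop :=
  forall (Q Q1 : query L) (d : step_data L),
    sclause d = c -> sld_step Q d Q1 ->
    forall Q' : query L, query_more_general D Q' Q ->
      exists (Q1' : query L) (d' : step_data L),
        [/\ sclause d' = c, sld_step Q' d' Q1' &
            is_lift D (single_step Q d Q1) (single_step Q' d' Q1')].

Definition DN_program (L : language) (D : lp_filter L) (P : set (clause L)) : Prop :=
  forall c, P c -> DN_clause D c.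

(* Main.v *)
Require Import Defs.
From mathcomp Require Import all_boot.
From mathcomp Require Import boolp classical_sets cardinality.

(** The DN property lifts one step at a time, but the input clause it provides
    need not be standardized apart from the history of the lift under
    construction.  Renaming the whole step is not allowed, since term-conditions
    are not invariant under renaming.  Instead, if [c] is the input clause and
    [theta] the mgu, let [rho] be an involution exchanging the variables of [c]
    with fresh ones: [c rho] is a valid input clause, [rho theta] is an mgu, and
    the resolvent is literally unchanged.  Lifting step by step, and then going
    on with arbitrary steps until none is possible, yields a maximal sequence. *)

Set Implicit Arguments.
Unset Strict Implicit.
Unset Printing Implicit Defensive.

Local Open Scope classical_set_scope.

Section Substitutions.
Context {L : language}.
Implicit Types (t : term L) (A B : atom L) (Q : query L) (c : clause L).

(** Arguments are nested inside a finite function; the explicit fixpoint supplies an induction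
    hypothesis for each of them. *)
Lemma term_ffun_ind (T : term L -> Prop) :
  (forall x, T (Var x)) ->
  (forall f (a : {ffun 'I_(farity f) -> term L}), (forall i, T (a i)) -> T (App a)) ->
  forall t, T t.
Proof.
move=> TV TA; fix rec 1 => -[x|f a]; first exact: TV.
by apply: TA => i; apply: rec.
Qed.

(** * Finiteness of variable sets *)

Lemma finite_tvars t : finite_set (tvars t).
Proof.
elim/term_ffun_ind: t => [x|f a IH] /=; first exact: finite_set1.
rewrite (_ : [set _ | _] = \bigcup_(i in setT) tvars (a i)).
  by apply: bigcup_finite => [|i _]; [apply: finite_finset | apply: IH].
by apply/seteqP; split=> x /= [i]; [exists i | move=> _ ?; exists i].
Qed.

Lemma finite_avars A : finite_set (avars A).
Proof.
rewrite (_ : avars A = \bigcup_(i in setT) tvars (aargs A i)).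
  by apply: bigcup_finite => [|i _]; [apply: finite_finset | apply: finite_tvars].
by apply/seteqP; split=> x /= [i]; [exists i | move=> _ ?; exists i].
Qed.

Lemma finite_qvars Q : finite_set (qvars Q).
Proof.
elim: Q => [|A Q IH]; first by apply: (sub_finite_set _ (@finite_set0 nat)) => x [].
apply: (@sub_finite_set _ _ (avars A `|` qvars Q)).
  by move=> x [B /= [<-|QB] Bx]; [left | right; exists B].
by rewrite finite_setU; split; [apply: finite_avars|].
Qed.

Lemma finite_cvars c : finite_set (cvars c).
Proof. by rewrite finite_setU; split; [apply: finite_avars|apply: finite_qvars]. Qed.

Lemma finite_svars (s : subst L) : finite_set (svars s).
Proof.
rewrite finite_setU; split; first exact: sfinite.
rewrite (_ : [set x | _] = \bigcup_(y in [set y | s y <> Var y]) tvars (s y)).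
  by apply: bigcup_finite => [|y _]; [apply: sfinite | apply: finite_tvars].
by apply/seteqP; split=> x /= [y ? ?]; exists y.
Qed.

Lemma finite_set_nat_bound (E : set nat) :
  finite_set E -> exists K, forall x, E x -> x < K.
Proof.
move=> /finite_seqP [s ->]; exists (\max_(i <- s) i).+1 => x /= xs.
by rewrite ltnS; apply: leq_bigmax_seq.
Qed.

(** * Composition of substitutions and its effect on variables *)

Lemma eq_in_tsubst (s r : nat -> term L) t :
  (forall x, tvars t x -> s x = r x) -> tsubst s t = tsubst r t.
Proof.
elim/term_ffun_ind: t => [x|f a IH] /= sr; first exact: sr.
congr App; apply/ffunP => i; rewrite !ffunE; apply: IH => x ax.
by apply: sr; exists i.
Qed.

Lemma tsubst_Var t : tsubst Var t = t.
Proof.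
elim/term_ffun_ind: t => [x|f a IH] //=.
by congr App; apply/ffunP => i; rewrite !ffunE.
Qed.

Lemma tsubst_tsubst (r s : nat -> term L) t :
  tsubst s (tsubst r t) = tsubst (fun x => tsubst s (r x)) t.
Proof.
elim/term_ffun_ind: t => [x|f a IH] //=.
by congr App; apply/ffunP => i; rewrite !ffunE.
Qed.

Lemma tvars_tsubst (s : nat -> term L) t x :
  tvars (tsubst s t) x -> exists2 y, tvars t y & tvars (s y) x.
Proof.
elim/term_ffun_ind: t => [y|f a IH] /=; first by exists y.
by move=> [i]; rewrite ffunE => /IH [y ay sx]; exists y => //; exists i.
Qed.

Lemma finite_scomp (r s : subst L) :
  finite_set [set x | tsubst s (r x) <> Var x].
Proof.
apply: (@sub_finite_set _ _ ([set x | r x <> Var x] `|` [set x | s x <> Var x])).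
  move=> x /= sx; have [rx|] := pselect (r x = Var x); last by left.
  by right=> /= ?; apply: sx; rewrite rx.
by rewrite finite_setU; split; apply: sfinite.
Qed.

(* In diagrammatic order: [r] is applied first. *)
Definition scomp (r s : subst L) : subst L := Subst (finite_scomp r s).

Lemma asubst_scomp (r s : subst L) A :
  asubst (scomp r s) A = asubst s (asubst r A).
Proof.
rewrite /asubst; congr Atom; apply/ffunP => i /=.
by rewrite !ffunE tsubst_tsubst.
Qed.

Lemma qsubst_scomp (r s : subst L) Q :
  qsubst (scomp r s) Q = qsubst s (qsubst r Q).
Proof.
rewrite /qsubst -map_comp; apply: eq_map => A /=; exact: asubst_scomp.
Qed.

Lemma csubst_scomp (r s : subst L) c :
  csubst (scomp r s) c = csubst s (csubst r c).
Proof. by rewrite /csubst /= asubst_scomp qsubst_scomp. Qed.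

Lemma asubst_id (s : subst L) A :
  (forall x, avars A x -> s x = Var x) -> asubst s A = A.
Proof.
case: A => p a sA; rewrite /asubst /=; congr Atom; apply/ffunP => i.
rewrite ffunE -[RHS]tsubst_Var; apply: eq_in_tsubst => x ax.
by apply: sA; exists i.
Qed.

Lemma qsubst_id (s : subst L) Q :
  (forall x, qvars Q x -> s x = Var x) -> qsubst s Q = Q.
Proof.
elim: Q => [|A Q IH] //= sQ; congr cons.
  by apply: asubst_id => x Ax; apply: sQ; exists A => //; left.
by apply: IH => x [B QB Bx]; apply: sQ; exists B => //; right.
Qed.

Lemma qsubst_cat (s : subst L) Q Q' :
  qsubst s (Q ++ Q') = qsubst s Q ++ qsubst s Q'.
Proof. exact: map_cat. Qed.

Lemma avars_asubst (s : subst L) A x :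
  avars (asubst s A) x -> exists2 y, avars A y & tvars (s y) x.
Proof.
by case=> i /=; rewrite ffunE => /tvars_tsubst [y Ay sx]; exists y => //; exists i.
Qed.

Lemma qvars_qsubst (s : subst L) Q x :
  qvars (qsubst s Q) x -> exists2 y, qvars Q y & tvars (s y) x.
Proof.
move=> [B /List.in_map_iff [A [<- QA]] /avars_asubst [y Ay sx]].
by exists y => //; exists A.
Qed.

Lemma cvars_csubst (s : subst L) c x :
  cvars (csubst s c) x -> exists2 y, cvars c y & tvars (s y) x.
Proof.
by case=> [/avars_asubst|/qvars_qsubst] [y cy sx]; exists y => //; [left|right].
Qed.

Lemma variant_trans c c' c'' : variant c c' -> variant c' c'' -> variant c c''.
Proof.
move=> [r [f bf rf] ->] [s [g bg sg] ->]; exists (scomp r s).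
  by exists (g \o f) => [|x /=]; [apply: bij_comp | rewrite rf /= sg].
by rewrite csubst_scomp.
Qed.

Lemma qvars_cons A Q : qvars (A :: Q) = avars A `|` qvars Q.
Proof.
apply/seteqP; split=> x; first by case=> B /= [<-|QB] Bx; [left|right; exists B].
by case=> [Ax|[B QB Bx]]; [exists A => //; left|exists B => //; right].
Qed.

Lemma qvars_cat Q Q' : qvars (Q ++ Q') = qvars Q `|` qvars Q'.
Proof.
elim: Q => [|A Q IH] /=; last by rewrite !qvars_cons IH setUA.
by apply/seteqP; split=> x; [right|case=> // -[]].
Qed.

(** * Fresh renamings and standardization of a single step *)

Lemma disjoint_setP (E F : set nat) :
  (E `&` F = set0) <-> (forall x, E x -> ~ F x).
Proof.
split=> [EF0 x Ex Fx|EF]; first by have : (E `&` F) x by []; rewrite EF0.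
by rewrite -subset0 => x [/EF].
Qed.

(** With [K] a strict bound of [V] and [W], exchange each [x] in [V] with [x + K] and fix everything
    else: the shifted copy of [V] avoids both sets. *)
Lemma exists_fresh_swap (V W : set nat) :
  finite_set V -> finite_set W -> V `&` W = set0 ->
  exists rho : subst L,
    [/\ renaming rho, forall x, tsubst rho (rho x) = Var x,
        forall x, W x -> rho x = Var x &
        forall x y, V x -> tvars (rho x) y -> ~ W y /\ ~ V y].
Proof.
move=> finV finW /disjoint_setP VW.
have [K bK] := @finite_set_nat_bound (V `|` W) ltac:(by rewrite finite_setU).
have VK x : V x -> x < K by move=> ?; apply: bK; left.
have WK x : W x -> x < K by move=> ?; apply: bK; right.
pose f x := if `[< V x >] then x + K
            else if (K <= x) && `[< V (x - K) >] then x - K else x.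
have fV x : V x -> f x = x + K by move=> Vx; rewrite /f asboolT.
have ff x : f (f x) = x.
  rewrite {2}/f; case: asboolP => [Vx|nVx].
    rewrite /f asboolF => [|/VK]; last by rewrite ltnNge leq_addl.
    by rewrite leq_addl addnK asboolT.
  case: ifPn => [/andP[Kx /asboolP Vx]|nx]; first by rewrite fV // subnK.
  by rewrite /f asboolF // (negbTE nx).
have finf : finite_set [set x | (fun x => Var (f x) : term L) x <> Var x].
  (* [V] lies below [K] and its copy below [K + K], so [f] moves nothing from [K + K] on. *)
  apply: (@sub_finite_set _ _ `I_(K + K)) => [x /= fx|]; last exact: finite_II.
  rewrite ltnNge; apply/negP => Kx; apply: fx; congr Var; rewrite /f asboolF.
    case: ifPn => // /andP[_ /asboolP /VK]; rewrite ltnNge.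
    by rewrite leq_subRL ?Kx // (leq_trans _ Kx) ?leq_addl.
  by move=> /VK; rewrite ltnNge (leq_trans _ Kx) ?leq_addl.
exists (Subst finf); split=> //=.
- by exists f => //; exists f.
- by move=> x; rewrite ff.
- move=> x Wx; congr Var; rewrite /f asboolF => [|Vx]; last exact: (VW x).
  by rewrite leqNgt WK.
- move=> x y Vx ->; rewrite fV //.
  by split=> [/WK|/VK]; rewrite ltnNge leq_addl.
Qed.

Lemma standardize_step Q (d : step_data L) Q1 (F : set nat) :
  sld_step Q d Q1 -> finite_set F ->
  exists d' : step_data L,
    [/\ sld_step Q d' Q1, sclause d' = sclause d, spos d' = spos d &
        cvars (sinput d') `&` F = set0].
Proof.
case: d => c c' p theta /= [A [B [C /= [QE sA var_cc' c'Q [mgu_theta Q1E]]]]] finF.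
(* The swap requires disjoint sets, so the variables of [c'] are removed from [F]; they are avoided
   anyway, since the swap sends [cvars c'] outside itself. *)
have finW : finite_set (qvars Q `|` (F `\` cvars c')).
  rewrite finite_setU; split; first exact: finite_qvars.
  exact: finite_setD.
have VW : cvars c' `&` (qvars Q `|` (F `\` cvars c')) = set0.
  by move/disjoint_setP: c'Q => c'Q; apply/disjoint_setP => x cx [/(c'Q _ cx)|[]].
have [rho [ren_rho rhoK rho_id rho_fresh]] :=
  exists_fresh_swap (finite_cvars c') finW VW.
have c''_fresh x : cvars (csubst rho c') x -> ~ qvars Q x /\ ~ F x.
  move=> /cvars_csubst [y c'y /(rho_fresh _ _ c'y) [nW nV]].
  by split=> ?; apply: nW; [left | right; split].
have AId (X : atom L) : asubst rho (asubst rho X) = X.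
  by rewrite -asubst_scomp asubst_id => // x _; apply: rhoK.
have QId (X : query L) : qsubst rho (qsubst rho X) = X.
  by rewrite -qsubst_scomp qsubst_id => // x _; apply: rhoK.
have rhoQ x : qvars Q x -> rho x = Var x by move=> Qx; apply: rho_id; left.
move: rhoQ; rewrite {1}QE qvars_cat qvars_cons => rhoQ.
have rhoA : qsubst rho A = A by apply: qsubst_id => x ?; apply: rhoQ; left.
have rhoB : asubst rho B = B by apply: asubst_id => x ?; apply: rhoQ; right; left.
have rhoC : qsubst rho C = C by apply: qsubst_id => x ?; apply: rhoQ; right; right.
exists (StepData c (csubst rho c') p (scomp rho theta)); split=> //=; last first.
  by apply/disjoint_setP => x /c''_fresh [].
exists A, B, C; split=> //=.
- by apply: variant_trans var_cc' _; exists rho.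
- by apply/disjoint_setP => x /c''_fresh [].
(* The resolvent is unchanged: [rho] fixes [A] and [C], and applied twice it cancels on the body of
   [c']. *)
split; last first.
  by rewrite qsubst_scomp !qsubst_cat QId rhoA rhoC Q1E !qsubst_cat.
case: mgu_theta => uni_theta gen_theta; split.
  by rewrite /unifier !asubst_scomp AId rhoB.
(* If [u] unifies [B] with the renamed head, then [rho u] unifies [B] with the original one, so
   [rho u = theta g]; composing with [rho] on the left gives [u = rho theta g]. *)
move=> u uni_u; have [|g gE] := gen_theta (scomp rho u).
  by rewrite /unifier !asubst_scomp rhoB.
exists g => x /=; rewrite tsubst_tsubst.
rewrite -(@eq_in_tsubst (scomp rho u)) => [/=|y _]; last exact: gE.
by rewrite -tsubst_tsubst rhoK.
Qed.

End Substitutions.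

(** * Stepwise construction of the lifted derivation *)

Theorem theorem2 (L : language) (P : set (clause L)) (D : lp_filter L)
  (Q0 Q0' : query L) (xi : sld_seq L) :
  finite_set P ->
  DN_program D P ->
  sld_derivation P Q0 xi ->
  query_more_general D Q0' Q0 ->
  exists xi' : sld_seq L, sld_derivation P Q0' xi' /\ is_lift D xi xi'.
Proof.
move=> _ DN_P [xi0 xi_seq xi_P _] gen0.
(* [F] is the set of variables excluded by standardization apart. *)
pose good i (Q : query L) (F : set nat) (e : step_data L * query L) :=
  [/\ P (sclause e.1), sld_step Q e.1 e.2, cvars (sinput e.1) `&` F = set0 &
      (* Past the end of [xi] this implication is vacuous, so any admissible step is good. *)
      has_step xi i ->
        [/\ sclause e.1 = sclause (sstep xi i), spos e.1 = spos (sstep xi i) &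
            query_more_general D e.2 (squery xi i.+1)]].
(* Arbitrary value for [next] where no good step exists. *)
have dflt : step_data L * query L := (sstep xi 0, Q0).
have [next nextP] : exists next : nat -> query L -> set nat -> step_data L * query L,
    forall i Q F, (exists e, good i Q F e) -> good i Q F (next i Q F).
  exists (fun i Q F => if pselect (exists e, good i Q F e) is left ex
                       then projT1 (cid ex) else dflt) => i Q F ex.
  by case: pselect => // ex'; case: cid.
(* The state carries the current query together with all variables used so far, so that each choice
   depends on the past only through it. *)
pose fix state i : query L * set nat :=
  if i is j.+1 then
    let e := next j (state j).1 (state j).2 in
    (e.2, (state j).2 `|` (svars (smgu e.1) `|` cvars (sinput e.1)))
  else (Q0', qvars Q0').
pose step i := (next i (state i).1 (state i).2).1.
pose possible i := exists e, good i (state i).1 (state i).2 e.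
have finF i : finite_set (state i).2.
  elim: i => [|i IH] /=; first exact: finite_qvars.
  rewrite finite_setU; split=> //.
  by rewrite finite_setU; split; [apply: finite_svars|apply: finite_cvars].
have apartP l i c :
    standardized_apart (SldSeq l (fun i => (state i).1) step) i c <->
    cvars c `&` (state i).2 = set0.
  rewrite /standardized_apart /=; elim: i => [|i IH] /=; first by split=> [[]|].
  rewrite 2!setIUr; split.
    move=> [c0 cj]; have [e1 e2] := cj i (ltnSn i).
    rewrite e1 e2 !setU0; apply/IH; split=> // j ji; apply: cj.
    exact: ltnW.
  rewrite 2!setU_eq0 => -[/IH[c0 cj] [e1 e2]].
  split=> // j; rewrite ltnS leq_eqVlt => /orP[/eqP ->//|]; exact: cj.
have stepP i : possible i -> good i (state i).1 (state i).2 (step i, (state i.+1).1).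
  by move=> /nextP; rewrite /step /=; case: (next _ _ _).
(* DN provides a lifted step; standardizing it keeps its resolvent, hence also the generality of
   that resolvent. *)
have lift_possible i : has_step xi i ->
    query_more_general D (state i).1 (squery xi i) -> possible i.
  move=> hi gen; have [Pc _] := xi_P i hi.
  have [Q1 [d [dc dstep [_ dlift dgen]]]] :=
    DN_P _ Pc _ _ _ erefl (xi_seq i hi) _ gen.
  have [d' [d'step d'c d'p d'F]] := standardize_step dstep (finF i).
  exists (d', Q1); split=> //=; first by rewrite d'c dc.
  move=> _; rewrite d'c dc d'p; split=> //; first by case: (dlift 0).
  exact: (dgen 1).
have query_of_step i : has_step xi i -> has_query xi i.
  by rewrite /has_query /has_step; case: (slen xi) => // n; apply: ltnW.
have step_of_query i : has_query xi i.+1 -> has_step xi i.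
  by rewrite /has_query /has_step; case: (slen xi).
have gen i : has_query xi i -> query_more_general D (state i).1 (squery xi i).
  elim: i => [_|i IH /step_of_query hi]; first by rewrite xi0.
  have geni := IH (query_of_step i hi).
  by have [_ _ _ /(_ hi) []] := stepP i (lift_possible i hi geni).
have xi_possible i : has_step xi i -> possible i.
  by move=> hi; apply: lift_possible => //; apply/gen/query_of_step.
(* The length is the least index at which no good step exists, or infinite if there is none. *)
have [l lP lmax] : exists2 l : option nat,
    forall i, (if l is Some n then is_true (i < n) else True) -> possible i &
    forall n, l = Some n -> ~ possible n.
  have [stuck|nstuck] := pselect (exists n, ~~ `[< possible n >]); last first.
    exists None => // i _; apply: contrapT => /asboolPn ni; apply: nstuck.
    by exists i.
  case: (ex_minnP stuck) => n /asboolPn nn n_min; exists (Some n) => [i lt_in|m [<-]//].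
  by apply: contrapT => /asboolPn /n_min; rewrite leqNgt lt_in.
exists (SldSeq l (fun i => (state i).1) step); split; last first.
  split=> //= [|i hi]; last by have [_ _ _ /(_ hi) []] := stepP i (xi_possible i hi).
  (* If the lift stops at [n], then [xi] has no step [n], since that step could be lifted. *)
  case: l lP lmax => [n|] _ lmax; last by case: (slen xi).
  move: (lmax n erefl) (xi_possible n); rewrite /length_le /has_step.
  case: (slen xi) => [m|] nn pn; last by apply: nn; apply: pn.
  by rewrite leqNgt; apply/negP => /pn.
split=> //=.
- by move=> i /lP /stepP [].
- by move=> i /lP /stepP [? _ ? _]; split=> //; apply/apartP.
move=> n ln [d [Q1 [Pd dstep /apartP dF]]]; apply: (lmax n ln).
(* If [xi] still has step [n], lifting it contradicts the choice of [l]; otherwise the supposed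
   extra step is itself good. *)
have [/xi_possible //|nhi] := pselect (has_step xi n).
by exists (d, Q1).
Qed.
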